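(* Let $\mathcal{H}$ be an $n$-dimensional Hilbert space, let $N\ge n$ and let $p>1$. Then $\delta_1^p=\frac{n}{N}$. Moreover, an $(N,n)$ dual pair $(F,G)$ for $\mathcal{H}$ is a $1$-erasure spectrally optimal dual pair if and only if it is $1$-uniform.
   Context: Hilbert spaces are real or complex and finite-dimensional. A sequence $F=\{f_i\}_{i=1}^N$ in $\mathcal{H}$ is a frame if there are $A,B>0$ with $A\|f\|^2\le\sum_{i=1}^N|\langle f,f_i\rangle|^2\le B\|f\|^2$ for all $f\in\mathcal{H}$. Its analysis operator is $\Theta_F:\mathcal{H}\to\mathbb{C}^N$ (or $\mathbb{R}^N$ in the real case), $\Theta_F f=(\langle f,f_i\rangle)_{i=1}^N$, with adjoint $\Theta_F^*(c_i)_i=\sum_i c_if_i$. A frame $G=\{g_i\}_{i=1}^N$ is a dual of $F$ if $f=\sum_{i=1}^N\langle f,f_i\rangle g_i$ for all $f\in\mathcal{H}$; then $(F,G)$ is called an $(N,n)$ dual pair. (Frames with $N$ elements exist exactly when $N\ge n$.) Let $\mathcal{D}^{(1)}$ be the set of $N\times N$ diagonal matrices with exactly one diagonal entry equal to $1$ and all others $0$. With $\rho$ the spectral radius (largest modulus of a complex eigenvalue), define $$\mathcal{E}_1^p(F,G)=\Big\{\frac1N\sum_{D\in\mathcal{D}^{(1)}}\big(\rho(\Theta_G^*D\Theta_F)\big)^p\Big\}^{1/p},\qquad \delta_1^p=\inf\{\mathcal{E}_1^p(F,G):(F,G)\text{ is an }(N,n)\text{ dual pair}\}.$$ (Here the superscript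 $p$ in $\mathcal{E}_1^p,\delta_1^p$ is an index, not a power.) A dual pair $(F,G)$ is a $1$-erasure spectrally optimal dual pair if $\mathcal{E}_1^p(F,G)=\delta_1^p$. A dual pair $(F,G)$ is $1$-uniform if there is a constant $c$ with $\langle f_i,g_i\rangle=c$ for all $1\le i\le N$. *)

(* Defs.v *)
From HB Require Import structures.
From mathcomp Require Import all_boot all_order all_algebra.
From mathcomp Require Import sesquilinear complex.
From mathcomp Require Import all_classical all_reals all_analysis.

Set Implicit Arguments.
Unset Strict Implicit.
Unset Printing Implicit Defensive.

Import Order.TTheory GRing.Theory Num.Theory.
Local Open Scope classical_set_scope.
Local Open Scope ring_scope.

(* A Hilbert space is a [vectType] over [scalars R k] (R or R[i]) with a
   positive definite form [{dot H for scalar_conj k}]; the form is linear in its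
   first argument and conjugate-linear in the second. *)
Variant scalar_kind := RealScalars | ComplexScalars.

Definition scalars (R : realType) (k : scalar_kind) : numFieldType :=
  match k with RealScalars => R | ComplexScalars => R[i] end.

Definition scalar_conj (R : realType) (k : scalar_kind) :
    scalars R k -> scalars R k :=
  match k with RealScalars => idfun | ComplexScalars => Num.conj end.
Arguments scalar_conj {R} k.

Definition to_complex (R : realType) (k : scalar_kind) : scalars R k -> R[i] :=
  match k with RealScalars => real_complex R | ComplexScalars => idfun end.
Arguments to_complex {R} k.

Section Frames.
Variables (R : realType) (k : scalar_kind).
Local Notation K := (scalars R k).
Variables (H : vectType K) (dot : {dot H for scalar_conj k}) (N : nat).
Implicit Types (F G : 'I_N -> H) (D : 'M[K]_N) (T : 'End(H)) (p : R).

(* Over R[i] the order is partial and [0 < A] makes [A] a positive real;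
   [dot f f] is the squared norm. *)
Definition is_frame F := exists A B : K,
  [/\ 0 < A, 0 < B & forall f,
    A * dot f f <= \sum_(i < N) `|dot f (F i)| ^+ 2 <= B * dot f f].

Definition analysis F (f : H) : 'cV[K]_N := \col_(i < N) dot f (F i).

(* The adjoint of [analysis F]. *)
Definition synthesis F (c : 'cV[K]_N) : H := \sum_(i < N) c i 0 *: F i.

Fact analysis_linear F : linear (analysis F).
Proof. by move=> a u v; apply/colP => i; rewrite !mxE linearPl. Qed.
HB.instance Definition _ F := GRing.isLinear.Build K H 'cV[K]_N _
  (analysis F) (analysis_linear F).

Fact synthesis_linear F : linear (synthesis F).
Proof.
move=> a u v; rewrite /synthesis scaler_sumr -big_split /=.
by apply: eq_bigr => i _; rewrite !mxE scalerDl scalerA.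
Qed.
HB.instance Definition _ F := GRing.isLinear.Build K 'cV[K]_N H _
  (synthesis F) (synthesis_linear F).

Definition dual_pair F G := [/\ is_frame F, is_frame G &
  forall f, f = \sum_(i < N) dot f (F i) *: G i].

Definition single_erasures : set 'M[K]_N :=
  [set D | is_diag_mx D /\
    exists i, D i i = 1 /\ forall j, j != i -> D j j = 0].

Definition error_operator F G D : 'End(H) :=
  linfun (synthesis G \o mulmx D \o analysis F).

(* Complex eigenvalues are those of the matrix of [T] in a basis of [H], seen as
   a complex matrix; the spectral radius is 0 if [H] is trivial. *)
Definition complex_eigenvalue T (z : R[i]) :=
  eigenvalue (map_mx (to_complex k)
                (passmx.mxof (vbasis {:H}) (vbasis {:H}) T)) z.

Definition spectral_radius T : R :=
  sup [set Normc.normc z | z in [set z | complex_eigenvalue T z]].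

Definition erasure_error p F G : R :=
  (N%:R^-1 * \sum_(D \in single_erasures)
                spectral_radius (error_operator F G D) `^ p) `^ p^-1.

Definition optimal_error p : R :=
  inf [set E | exists F G, dual_pair F G /\ E = erasure_error p F G].

Definition spectrally_optimal p F G :=
  dual_pair F G /\ erasure_error p F G = optimal_error p.

Definition one_uniform F G :=
  dual_pair F G /\ exists c : K, forall i, dot (F i) (G i) = c.

End Frames.

(* Main.v *)
Require Import Defs.
From HB Require Import structures.
From mathcomp Require Import all_boot all_order all_algebra.
From mathcomp Require Import sesquilinear complex.
From mathcomp Require Import all_classical all_reals all_analysis.
From mathcomp Require Import ring lra.

Set Implicit Arguments.
Unset Strict Implicit.
Unset Printing Implicit Defensive.

Import Order.TTheory GRing.Theory Num.Theory.
Local Open Scope ring_scope.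

(** Erasing all but the coefficient of index [i] turns the reconstruction into
    the rank one operator [f |-> <f, F i> G i].  Its only possibly nonzero
    eigenvalue is [t i = <G i, F i>], so its spectral radius is [|t i|]
    ([spectral_radius_error_operator]), and the error is the [p]-mean of the
    [|t i|] ([erasure_errorE]).  Taking the trace of
    [id = \sum_i <., F i> G i] gives [\sum_i t i = n] ([sum_dot_dual]), hence
    [n <= \sum_i |t i|].

    Put [m = n / N].  For [p > 1] the graph of [x |-> x `^ p] on [x >= 0] lies
    above its tangent at [m] and touches it only there ([powR_tangent_lt]).
    Summing over [i], the [p]-mean of the [|t i|] is at least [m], with equality
    only if [|t i| = m] for all [i] ([power_mean_ge], [power_mean_eq]).  In that
    case [\sum_i Re (t i) = n = \sum_i |t i|], so each [t i] equals [m].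
    Conversely a 1-uniform pair has [t i = m] for all [i] by the trace identity,
    and its error is [m].

    It remains to exhibit a dual pair with [t i = m] for all [i]
    ([exists_uniform_dual_pair]).  No tight frame is needed.  Let [e] be a basis
    of [H], [h] the basis biorthogonal to it, [s] the sum of the [e j] and [u]
    the sum of the [h j].  As values of [(F i, G i)] take the pairs
    [(h j, e j - ((N - n) / N) s)] for [j < n], followed by [N - n] copies of
    [(u, s / N)].  The frame inequalities hold for every two families that
    satisfy the reconstruction formula, by the Cauchy-Schwarz inequality
    ([dual_is_frame]). *)

(** * Conjugation and complexification of the scalars *)

Section Scalars.
Variables (R : realType) (k : scalar_kind).
Local Notation K := (scalars R k).

Fact scalar_conj_is_zmod_morphism : zmod_morphism (@scalar_conj R k).
Proof. by case: k => // x y; exact: (rmorphB (@Num.conj R[i])). Qed.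
Fact scalar_conj_is_monoid_morphism : monoid_morphism (@scalar_conj R k).
Proof.
by case: k; split=> // *; [exact: (rmorph1 Num.conj)|exact: (rmorphM Num.conj)].
Qed.
HB.instance Definition _ := GRing.isZmodMorphism.Build K K
  (@scalar_conj R k) scalar_conj_is_zmod_morphism.
HB.instance Definition _ := GRing.isMonoidMorphism.Build K K
  (@scalar_conj R k) scalar_conj_is_monoid_morphism.

Fact to_complex_is_zmod_morphism : zmod_morphism (@to_complex R k).
Proof. by case: k => // x y; exact: (rmorphB (real_complex R)). Qed.
Fact to_complex_is_monoid_morphism : monoid_morphism (@to_complex R k).
Proof. by case: k; split=> // *; exact: (rmorphM (real_complex R)). Qed.
HB.instance Definition _ := GRing.isZmodMorphism.Build K R[i]
  (@to_complex R k) to_complex_is_zmod_morphism.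
HB.instance Definition _ := GRing.isMonoidMorphism.Build K R[i]
  (@to_complex R k) to_complex_is_monoid_morphism.

Lemma scalar_conjK : involutive (@scalar_conj R k).
Proof. by case: k => // x; exact: conjCK. Qed.

Lemma mul_scalar_conj (x : K) : x * scalar_conj k x = `|x| ^+ 2.
Proof.
move: x; rewrite /scalars; case: k => x /=; last by rewrite normCK.
by rewrite real_normK ?num_real// expr2.
Qed.

Lemma norm_scalar_conj (x : K) : `|scalar_conj k x| = `|x|.
Proof. by move: x; rewrite /scalars; case: k => x //=; rewrite norm_conjC. Qed.

End Scalars.

(** * The tangent line inequality for real powers *)

Section Reals.
Variable R : realType.
Implicit Types p x m : R.

(** Bernoulli's inequality for a real exponent, in its strict form. *)
Lemma bernoulli_powR p x : 1 < p -> 0 <= x -> x != 1 ->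
  1 + p * (x - 1) < x `^ p.
Proof.
move=> p1 x0 x1.
have [->|xn0] := eqVneq x 0; first by rewrite powR0 ?gt_eqF//; lra.
have xp : 0 < x by rewrite lt_def xn0.
have [L0|L0] := leP (1 + p * (x - 1)) 0.
  by apply: le_lt_trans L0 _; apply: powR_gt0.
set L := 1 + _ in L0 *.
rewrite /powR (negPf xn0) -[ltLHS]lnK ?posrE// ltr_expR.
(* [x] is the mean of [1 + p * (x - 1)] and [1] with weights [1 / p] and
   [1 - 1 / p]; the bound [1 + u <= expR u] at the logarithms of both values
   divided by [x] gives the concavity inequality for [ln] at [x]. *)
have lnL : ln L - ln x <= L / x - 1.
  have := expR_ge1Dx (ln (L / x)).
  by rewrite lnK ?posrE ?divr_gt0// ln_div ?posrE//; lra.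
have lnx : - ln x < x^-1 - 1.
  have := @expR_gt1Dx R (- ln x).
  by rewrite oppr_eq0 ln_eq0// x1 => /(_ isT); rewrite expRN lnK ?posrE//; lra.
have p10 : 0 < p - 1 by lra.
have := ltr_pM2l p10 (- ln x) (x^-1 - 1); rewrite lnx => lnpx.
have E : L / x + (p - 1) * x^-1 = p.
  by rewrite /L; field.
lra.
Qed.

(** The graph of [x |-> x `^ p] lies strictly above its tangent at [m], except
    at [m] itself. *)
Lemma powR_tangent_lt p m x : 1 < p -> 0 <= m -> 0 <= x -> x != m ->
  m `^ p + p * m `^ (p - 1) * (x - m) < x `^ p.
Proof.
move=> p1 m0 x0 xm.
have p0 : 0 < p by apply: lt_trans p1.
(* At [m = 0] the tangent is the horizontal axis, as [p - 1 != 0]; otherwise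
   rescale by [m]. *)
have [m00|mn0] := eqVneq m 0.
  rewrite m00 in xm *; rewrite !powR0 ?subr_eq0 ?gt_eqF// mulr0 mul0r addr0.
  by rewrite powR_gt0// lt_def xm.
have mp : 0 < m by rewrite lt_def mn0.
have -> : x = m * (x / m) by rewrite mulrCA mulfV// mulr1.
have := @bernoulli_powR p (x / m) p1 (divr_ge0 x0 m0).
have -> : x / m != 1 by rewrite (can2_eq (divfK mn0) (mulfK mn0)) mul1r.
move=> /(_ isT) h; rewrite powRM// ?divr_ge0// -(mulr_powRB1 m0 p0).
rewrite -subr_gt0 in h; rewrite -subr_gt0.
set P := m `^ (p - 1) in h *; have P0 : 0 < P by apply: powR_gt0.
(* Multiply the inequality at [x / m] by [m `^ p = m * P]. *)
have := mulr_gt0 (mulr_gt0 mp P0) h; congr (_ < _).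
rewrite mulrBr; congr (_ - _).
by rewrite mulrDr mulr1; congr (_ + _); rewrite mulrBr mulr1 !mulrA; ring.
Qed.

Lemma powR_tangent_le p m x : 1 < p -> 0 <= m -> 0 <= x ->
  m `^ p + p * m `^ (p - 1) * (x - m) <= x `^ p.
Proof.
move=> p1 m0 x0; have [->|xm] := eqVneq x m; first by rewrite subrr mulr0 addr0.
exact/ltW/powR_tangent_lt.
Qed.

End Reals.

(** * Rank one operators and the error of a pair of families *)

Section RankOne.
Variables (F : fieldType) (m : nat) (c : 'cV[F]_m) (r : 'rV[F]_m).

Lemma eigenvalue_rank1 z : eigenvalue (c *m r) z -> z = 0 \/ z = (r *m c) 0 0.
Proof.
move=> /eigenvalueP[v vE v0].
have [->|z0] := eqVneq z 0; [by left|right].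
have vc : (v *m c) 0 0 *: r = z *: v.
  by rewrite -vE mulmxA -mul_scalar_mx -mx11_scalar.
have s0 : (v *m c) 0 0 != 0.
  apply: contraNneq v0 => s0; move/eqP: vc.
  by rewrite s0 scale0r eq_sym scaler_eq0 (negPf z0).
apply: (mulfI s0); have := congr1 (fun w : 'rV_m => (w *m c) 0 0) vc.
by rewrite -!scalemxAl !mxE mulrC => ->; rewrite mulrC.
Qed.

Lemma rank1_eigenvalue :
  (r *m c) 0 0 != 0 -> eigenvalue (c *m r) ((r *m c) 0 0).
Proof.
move=> rc0; apply/eigenvalueP; exists r.
  by rewrite mulmxA -mul_scalar_mx -mx11_scalar.
by apply: contraNneq rc0 => ->; rewrite mul0mx mxE.
Qed.
End RankOne.

Lemma fsbig_setT_fin (V : nmodType) (I : finType) (f : I -> V) :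
  \sum_(i \in [set: I]) f i = \sum_i f i.
Proof.
rewrite (fsbigE (index_enum I)).
- by apply: eq_bigl => i; rewrite in_setT.
- exact: index_enum_uniq.
- by [].
- by move=> i _; rewrite mem_index_enum.
Qed.

Section Frames.
Variables (R : realType) (k : scalar_kind).
Local Notation K := (scalars R k).
Variables (H : vectType K) (dot : {dot H for scalar_conj k}) (N : nat).
Implicit Types (F G : 'I_N -> H).

Lemma dotC u v : dot u v = scalar_conj k (dot v u).
Proof. by rewrite hermC expr0 mul1r. Qed.

Lemma dot_ge0 u : 0 <= dot u u.
Proof.
by have [->|/neq0_dnorm_gt0/ltW//] := eqVneq u 0; rewrite linear0r.
Qed.

Lemma dot_eq0 u : dot u u = 0 -> u = 0.
Proof.
move=> uu; apply/eqP; apply: contraTT isT => u0.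
by have := neq0_dnorm_gt0 (s := dot) u u0; rewrite uu ltxx.
Qed.

Lemma dotZ_sumr (I : finType) (a : I -> K) (v : I -> H) u :
  dot u (\sum_i a i *: v i) = \sum_i scalar_conj k (a i) * dot u (v i).
Proof.
rewrite dotC linear_sumlz rmorph_sum; apply: eq_bigr => i _ /=.
by rewrite linearZl_LR /= rmorphM /= -dotC.
Qed.

Lemma dotZ_suml (I : finType) (a : I -> K) (v : I -> H) u :
  dot (\sum_i a i *: v i) u = \sum_i a i * dot (v i) u.
Proof. by rewrite linear_sumlz; apply: eq_bigr => i _; rewrite linearZl_LR. Qed.

(** For both scalar fields at once: the component of [u] orthogonal to [v] has
    nonnegative square norm. *)
Lemma dot_cauchy_schwarz u v : `|dot u v| ^+ 2 <= dot u u * dot v v.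
Proof.
have [->|v0] := eqVneq v 0.
  by rewrite [dot u 0]linear0r [dot 0 0]linear0r mulr0 normr0 expr0n.
have vv : 0 < dot v v by exact: neq0_dnorm_gt0.
set c := dot u v / dot v v.
have := dot_ge0 (u - c *: v).
have -> : dot (u - c *: v) (u - c *: v) = dot u u - `|dot u v| ^+ 2 / dot v v.
  have e1 : dot (u - c *: v) v = 0.
    by rewrite linearBl/= linearZl_LR/= /c mulfVK ?subrr ?gt_eqF.
  have e2 : dot (u - c *: v) (u - c *: v) = dot (u - c *: v) u.
    rewrite linearBr/= [dot _ (c *: v)]dotC linearZl_LR/= rmorphM/= -dotC e1.
    by rewrite mulr0 subr0.
  rewrite e2 linearBl/= linearZl_LR/= [dot v u]dotC /c -mul_scalar_conj.
  by rewrite mulrAC.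
by rewrite subr_ge0 ler_pdivrMr.
Qed.

Lemma dot_coordl (e : (\dim {:H}).-tuple H) (u v : H) : basis_of {:H} e ->
  dot u v = \sum_i coord e i u * dot e`_i v.
Proof.
by move=> eb; rewrite {1}(coord_basis eb (memvf u)) dotZ_suml.
Qed.

Lemma error_operator_delta F G i f :
  error_operator dot F G (delta_mx i i) f = dot f (F i) *: G i.
Proof.
rewrite lfunE /= /synthesis (bigD1 i)//= big1 ?addr0 => [|j ji].
  rewrite mxE (bigD1 i)//= big1 ?addr0 => [|l li]; rewrite !mxE !eqxx ?mul1r//.
  by rewrite (negPf li) andbF mul0r.
by rewrite mxE big1 ?scale0r// => l _; rewrite !mxE (negPf ji) mul0r.
Qed.

Lemma mxof_error_operator (e : (\dim {:H}).-tuple H) F G i :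
  passmx.mxof e e (error_operator dot F G (delta_mx i i)) =
  (\col_l dot e`_l (F i)) *m passmx.rVof e (G i).
Proof.
apply/matrixP => a b.
rewrite [LHS]mxE [passmx.rVof]lock /= passmx.vecof_delta error_operator_delta.
by rewrite -lock !mxE big_ord1 !mxE linearZ.
Qed.

(** The modulus of a scalar as an element of [R]; the norm [`|x|] of [x] lies in
    the scalar field itself. *)
Definition modulus (x : K) : R := Normc.normc (to_complex k x).

Lemma spectral_radius_error_operator F G i :
  spectral_radius (error_operator dot F G (delta_mx i i)) =
  modulus (dot (G i) (F i)).
Proof.
rewrite /spectral_radius /complex_eigenvalue mxof_error_operator map_mxM.
set e := vbasis _; set c := map_mx _ _; set r := map_mx _ _.
have rcE : (r *m c) 0 0 = to_complex k (dot (G i) (F i)).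
  rewrite -map_mxM mxE; congr to_complex; rewrite mxE.
  rewrite (dot_coordl (G i) (F i) (vbasisP {:H})).
  by apply: eq_bigr => l _; rewrite !mxE.
rewrite /modulus -rcE; set t := (r *m c) 0 0.
(* If [t = 0], the set of moduli may be empty or not; its supremum is 0 in
   both cases. *)
have [t0|t0] := eqVneq t 0.
  rewrite t0 Normc.normc0; set A := (X in sup X).
  have : (A `<=` [set 0])%classic.
    move=> _ [z /= /eigenvalue_rank1 zE <-].
    by have -> : z = 0; [rewrite -/t t0 in zE; case: zE | rewrite Normc.normc0].
  by move/subset_set1 => [->|->]; rewrite ?sup0 ?sup1.
have At : [set Normc.normc z | z in [set z | eigenvalue (c *m r) z]]%classic
    (Normc.normc t) by exists t => //; apply: rank1_eigenvalue.
have ubt : ubound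
    [set Normc.normc z | z in [set z | eigenvalue (c *m r) z]]%classic
    (Normc.normc t).
  move=> _ [z /= /eigenvalue_rank1[->|->] <-] //.
  by rewrite Normc.normc0 /Normc.normc; case: (t) => *; apply: sqrtr_ge0.
apply/le_anti/andP; split.
  by apply: ge_sup => //; eexists; exact: At.
by apply: ub_le_sup => //; eexists; exact: ubt.
Qed.

Lemma single_erasuresE : @single_erasures R k N =
  [set delta_mx i i | i in [set: 'I_N]]%classic.
Proof.
apply/seteqP; split => [D [/is_diag_mxP Dd [i [Di Dj]]]|_ [i _ <-]].
  exists i => //; apply/matrixP => a b; rewrite mxE.
  have [->|ab] := eqVneq a b; last first.
    by rewrite Dd//; case: eqVneq => // ai; rewrite -ai eq_sym (negPf ab).
  by rewrite andbb; case: eqVneq => [->//|bi]; rewrite Dj.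
split; last first.
  exists i; rewrite mxE eqxx; split=> // j ji.
  by rewrite mxE (negPf ji).
apply/is_diag_mxP => a b ab; rewrite mxE.
case: (eqVneq a i) => //= ai; case: (eqVneq b i) => // bi.
by rewrite ai bi eqxx in ab.
Qed.

Lemma erasure_errorE p F G : erasure_error dot p F G =
  (N%:R^-1 * \sum_(i < N) modulus (dot (G i) (F i)) `^ p) `^ p^-1.
Proof.
rewrite /erasure_error single_erasuresE fsbig_image; last first.
  move=> i j _ _ /matrixP/(_ i i); rewrite !mxE eqxx/= andbb => /esym/eqP.
  by case: (eqVneq i j) => // _; rewrite eq_sym oner_eq0.
rewrite fsbig_setT_fin; congr ((_ * _) `^ _).
by apply: eq_bigr => i _; rewrite spectral_radius_error_operator.
Qed.

(** The trace of the identity, written as the sum of the rank one operators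
    [f |-> <f, F i> G i], is the dimension. *)
Lemma sum_dot_dual F G :
  (forall f, f = \sum_(i < N) dot f (F i) *: G i) ->
  \sum_(i < N) dot (G i) (F i) = (\dim {:H})%:R.
Proof.
move=> FG; set e := vbasis {:H}.
have eb : basis_of {:H} e by exact: vbasisP.
under eq_bigr do rewrite (dot_coordl _ _ eb).
rewrite exchange_big/=.
transitivity (\sum_(l < \dim {:H}) (1 : K)); last first.
  by rewrite sumr_const card_ord.
apply: eq_bigr => l _.
have := coord_free l l (basis_free eb); rewrite eqxx {1}(FG e`_l) linear_sum/=.
move=> h; apply: etrans h; apply: eq_bigr => i _.
by rewrite linearZ/= mulrC.
Qed.

End Frames.

(** * Reconstruction implies the frame inequalities *)

Lemma mean_square_le (K : numFieldType) (x y B : K) :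
  0 <= x -> 0 <= y -> 0 < B ->
  x * y *+ 2 <= B * x ^+ 2 + B^-1 * y ^+ 2.
Proof.
move=> x0 y0 B0; have xy : (B * x - y) \is Num.real.
  by rewrite rpredB ?rpredM// ger0_real// ltW.
rewrite -subr_ge0; have -> : B * x ^+ 2 + B^-1 * y ^+ 2 - x * y *+ 2 =
    B^-1 * (B * x - y) ^+ 2 by field; rewrite gt_eqF.
by rewrite mulr_ge0 ?invr_ge0 -?realEsqr ?ltW.
Qed.

Section DualPairs.
Variables (R : realType) (k : scalar_kind).
Local Notation K := (scalars R k).
Variables (H : vectType K) (dot : {dot H for scalar_conj k}) (N : nat).
Implicit Types (F G : 'I_N -> H).

(** The upper frame bound. *)
Lemma bessel F : exists2 B : K, 0 < B & forall f,
  \sum_(i < N) `|dot f (F i)| ^+ 2 <= B * dot f f.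
Proof.
exists (1 + \sum_(i < N) dot (F i) (F i)).
  by rewrite ltr_pwDl// sumr_ge0// => i _; apply: dot_ge0.
move=> f; rewrite mulrDl mul1r ler_wpDl ?dot_ge0// mulr_suml.
by apply: ler_sum => i _; rewrite mulrC dot_cauchy_schwarz.
Qed.

(** Reconstruction is symmetric in the two families, by taking adjoints. *)
Lemma dual_sym F G :
  (forall f, f = \sum_(i < N) dot f (F i) *: G i) ->
  forall f, f = \sum_(i < N) dot f (G i) *: F i.
Proof.
move=> FG f; apply/eqP; rewrite -subr_eq0; set g := _ - _.
apply/eqP/(dot_eq0 (dot := dot)).
rewrite {1}/g linearBl/= dotZ_suml {1}(FG g) dotZ_sumr.
apply/eqP; rewrite subr_eq0; apply/eqP/eq_bigr => i _.
by rewrite -dotC mulrC.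
Qed.

Lemma dual_is_frame F G :
  (forall f, f = \sum_(i < N) dot f (F i) *: G i) -> is_frame dot F.
Proof.
move=> FG; have [B B0 GB] := bessel G; have [C C0 FC] := bessel F.
exists B^-1, C; split=> // [|f]; first by rewrite invr_gt0.
rewrite FC andbT ler_pdivrMl//.
have ff : dot f f <= \sum_(i < N) `|dot f (F i)| * `|dot f (G i)|.
  rewrite -[leLHS](ger0_norm (dot_ge0 dot f)) {1}(FG f) dotZ_suml.
  apply: le_trans (ler_norm_sum _ _ _) _; apply: ler_sum => i _.
  by rewrite normrM [dot (G i) f]dotC norm_scalar_conj.
have : dot f f *+ 2 <=
    B * (\sum_(i < N) `|dot f (F i)| ^+ 2) +
    B^-1 * \sum_(i < N) `|dot f (G i)| ^+ 2.
  apply: (@le_trans _ _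
    ((\sum_(i < N) `|dot f (F i)| * `|dot f (G i)|) *+ 2)).
    by rewrite lerMn2r.
  rewrite !mulr_sumr -big_split/= -sumrMnl; apply: ler_sum => i _.
  exact: mean_square_le.
(* The Bessel bound [B] of [G] bounds the second sum by [dot f f], which
   cancels one of the two copies on the left. *)
rewrite mulr2n => h.
have h2 : B^-1 * \sum_(i < N) `|dot f (G i)| ^+ 2 <= dot f f.
  by rewrite ler_pdivrMl.
by have := le_trans h (lerD (lexx _) h2); rewrite lerD2r.
Qed.

Lemma dual_pairP F G : dual_pair dot F G <->
  forall f, f = \sum_(i < N) dot f (F i) *: G i.
Proof.
split=> [[]//|FG]; split=> //; first exact: dual_is_frame FG.
exact: dual_is_frame (dual_sym FG).
Qed.

(** * A dual pair with constant inner products *)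

(** The coordinate functionals of a basis are inner products: the Gram matrix
    [M] of the basis is invertible because the form is definite. *)
Lemma biorthogonal_basis (e : (\dim {:H}).-tuple H) : basis_of {:H} e ->
  exists h : 'I_(\dim {:H}) -> H, forall i f, dot f (h i) = coord e i f.
Proof.
move=> eb; pose M := \matrix_(i, j) dot e`_i e`_j : 'M[K]_(\dim {:H}).
have Mu : M \in unitmx.
  rewrite -row_free_unit -kermx_eq0; apply/eqP/row_matrixP => i.
  (* A vector [u] of the kernel consists of the coordinates of a vector that is
     orthogonal to the basis, hence to itself. *)
  rewrite row0; set u := row i _.
  have uM : u *m M = 0 by apply/sub_kermxP; apply: row_sub.
  apply/eqP; rewrite -(passmx.vecof_eq0 eb); set v := passmx.vecof e u.
  apply/eqP/(dot_eq0 (dot := dot)).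
  rewrite {2}/v /passmx.vecof dotZ_sumr big1// => j _.
  have -> : dot v e`_j = (u *m M) 0 j.
    rewrite /v /passmx.vecof dotZ_suml mxE.
    by apply: eq_bigr => l _; rewrite !mxE.
  by rewrite uM [X in _ * X]mxE mulr0.
exists (fun i => \sum_j scalar_conj k (invmx M j i) *: e`_j) => i f.
rewrite dotZ_sumr.
transitivity ((passmx.rVof e f *m M *m invmx M) 0 i); last first.
  by rewrite mulmxK// mxE.
rewrite mxE; apply: eq_bigr => j _.
rewrite scalar_conjK mulrC (dot_coordl _ _ _ eb) mxE; congr (_ * _).
by apply: eq_bigr => l _; rewrite !mxE.
Qed.

(** On the first [n] indices [<G i, F i> = 1 - (N - n) / N], on the others
    [<G i, F i> = n / N]. *)
Lemma exists_uniform_dual_pair : (\dim {:H} <= N)%N ->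
  exists F G, dual_pair dot F G /\
    forall i, dot (G i) (F i) = (\dim {:H})%:R / N%:R.
Proof.
set n := \dim {:H} => nN.
have eb : basis_of {:H} (vbasis {:H}) by exact: vbasisP.
set e := vbasis _ in eb.
have [h hE] := biorthogonal_basis eb.
pose s := \sum_(j < n) e`_j; pose u := \sum_(j < n) h j.
pose a : K := (N - n)%:R / N%:R.
pose F (i : 'I_N) := if insub (val i) is Some j then h j else u.
pose G (i : 'I_N) : H :=
  if (insub (val i) : option 'I_n) is Some j then e`_j - a *: s
  else N%:R^-1 *: s.
have F1 (i : 'I_n) : F (widen_ord nN i) = h i.
  by rewrite /F /= insubT //= => lt; congr h; apply: val_inj.
have G1 (i : 'I_n) : G (widen_ord nN i) = e`_i - a *: s.
  by rewrite /G /= insubT //=.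
have F2 (i : 'I_N) : (n <= i)%N -> F i = u.
  by move=> ni; rewrite /F insubF// ltnNge ni.
have G2 (i : 'I_N) : (n <= i)%N -> G i = N%:R^-1 *: s.
  by move=> ni; rewrite /G insubF// ltnNge ni.
have sumE f : dot f u = \sum_(j < n) coord e j f.
  by rewrite /u linear_sumr; apply: eq_bigr => j _; exact: hE.
have coord_s j : coord e j s = 1.
  rewrite /s linear_sum (bigD1 j)//= coord_free ?(basis_free eb)// eqxx.
  rewrite big1 ?addr0// => l lj.
  by rewrite coord_free ?(basis_free eb)// (negPf lj).
exists F, G; split.
  apply/dual_pairP => f.
  rewrite (bigID (fun i : 'I_N => (i < n)%N))/=.
  rewrite (big_ord_narrow nN).
  have -> : \sum_(i < N | ~~ (i < n)%N) dot f (F i) *: G i =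
      (dot f u * a) *: s.
    rewrite (eq_bigr (fun=> dot f u *: (N%:R^-1 *: s))) => [|i]; last first.
      by rewrite -leqNgt => ni; rewrite (F2 _ ni) (G2 _ ni).
    rewrite sumr_const scalerMnl.
    have -> : #|[pred i : 'I_N | ~~ (i < n)%N]| = (N - n)%N.
      have := cardC [pred i : 'I_N | (i < n)%N].
      rewrite -[X in (X + _)%N = _]sum1_card (big_ord_narrow nN).
      rewrite sum1_card !card_ord.
      by move/(congr1 (subn^~ n)); rewrite addKn.
    by rewrite scalerA mulrnAl -mulrnAr -mulr_natl.
  under eq_bigr => i _ do rewrite F1 G1 hE scalerBr scalerA.
  rewrite sumrB -scaler_suml -mulr_suml -sumE subrK.
  by rewrite [LHS](coord_basis eb (memvf f)).
move=> i; have [ni|ni] := leqP n i.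
  rewrite (F2 _ ni) (G2 _ ni) linearZl_LR/= sumE.
  rewrite (eq_bigr (fun=> 1)) => [|j _]; last exact: coord_s.
  by rewrite sumr_const card_ord mulrC.
have N0 : N%:R != 0 :> K.
  by rewrite pnatr_eq0 -lt0n (leq_ltn_trans _ (ltn_ord i)).
have -> : i = widen_ord nN (Ordinal ni) by apply: val_inj.
move: (Ordinal ni) => j; rewrite F1 G1 hE linearB linearZ/= coord_s.
rewrite (coord_free _ _ (basis_free eb)) eqxx mulr1.
by rewrite /a natrB// mulrBl mulfV// opprB addrCA subrr addr0.
Qed.

End DualPairs.

(** * Power means *)

Section PowerMean.
Variables (R : realType) (N : nat) (p m : R) (a : 'I_N -> R).
Hypotheses (p1 : 1 < p) (m0 : 0 <= m) (a0 : forall i, 0 <= a i).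

Let p0 : 0 < p. Proof. exact: lt_trans p1. Qed.

Let powRK : (m `^ p) `^ p^-1 = m.
Proof. by rewrite -powRrM mulfV ?powRr1// gt_eqF. Qed.

Lemma power_mean_const : (0 < N)%N -> (forall i, a i = m) ->
  (N%:R^-1 * \sum_i a i `^ p) `^ p^-1 = m.
Proof.
move=> N0 am; under eq_bigr do rewrite am.
rewrite sumr_const card_ord -[_ `^ _ *+ N]mulr_natl mulrA.
rewrite mulVf ?pnatr_eq0 -?lt0n//.
by rewrite mul1r powRK.
Qed.

Hypothesis ma : m *+ N <= \sum_i a i.

Let sum_tangent : m `^ p *+ N <=
  \sum_i (m `^ p + p * m `^ (p - 1) * (a i - m)).
Proof.
rewrite big_split/= sumr_const card_ord -mulr_sumr lerDl mulr_ge0//.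
  by rewrite mulr_ge0 ?powR_ge0// ltW.
by rewrite sumrB sumr_const card_ord subr_ge0.
Qed.

Lemma power_mean_ge : (0 < N)%N -> m <= (N%:R^-1 * \sum_i a i `^ p) `^ p^-1.
Proof.
move=> N0; rewrite -[leLHS]powRK; apply: ge0_ler_powR.
- by rewrite invr_ge0 ltW.
- exact: powR_ge0.
- by rewrite nnegrE mulr_ge0 ?invr_ge0// sumr_ge0// => i _; apply: powR_ge0.
rewrite ler_pdivlMl ?ltr0n// mulr_natl; apply: le_trans sum_tangent _.
by apply: ler_sum => i _; apply: powR_tangent_le.
Qed.

Lemma power_mean_eq : (N%:R^-1 * \sum_i a i `^ p) `^ p^-1 = m ->
  forall i, a i = m.
Proof.
move=> E i; apply/eqP/negPn/negP => ai.
have N0 : (0 < N)%N by apply: leq_ltn_trans (ltn_ord i).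
have : m `^ p *+ N < \sum_i a i `^ p.
  apply: le_lt_trans sum_tangent _.
  rewrite (bigD1 i)//= [ltRHS](bigD1 i)//= ltr_leD//.
    exact: powR_tangent_lt.
  by apply: ler_sum => j _; apply: powR_tangent_le.
rewrite -[in X in X -> _]E -powRrM mulVf ?gt_eqF//.
rewrite powRr1; last first.
  by rewrite mulr_ge0 ?invr_ge0// sumr_ge0// => j _; apply: powR_ge0.
by rewrite -[_ * _ *+ N]mulr_natl mulrA mulfV ?mul1r ?ltxx// pnatr_eq0 -lt0n.
Qed.

End PowerMean.

(** * Moduli and real parts *)

Section Modulus.
Variables (R : realType) (k : scalar_kind).
Local Notation K := (scalars R k).
Implicit Types x : K.

Let ReD : {morph @complex.Re R : z w / z + w}.
Proof. by move=> [? ?] [? ?]. Qed.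

Lemma Re_le_modulus x : complex.Re (to_complex k x) <= modulus x.
Proof.
rewrite /modulus; case: (to_complex k x) => a b /=.
apply: le_trans (ler_norm a) _.
by rewrite -sqrtr_sqr ler_wsqrtr ?lerDl ?sqr_ge0.
Qed.

Lemma modulus_ge0 x : 0 <= modulus x.
Proof. by rewrite /modulus; case: to_complex => *; apply: sqrtr_ge0. Qed.

Lemma modulus_eq_Re x : modulus x = complex.Re (to_complex k x) ->
  to_complex k x = (modulus x)%:C%C.
Proof.
rewrite /modulus; case: (to_complex k x) => a b /= h.
have b0 : b = 0.
  apply/eqP; rewrite -sqrf_eq0; have := congr1 (fun y => y ^+ 2) h.
  rewrite /= sqr_sqrtr ?addr_ge0 ?sqr_ge0// => /eqP.
  by rewrite -subr_eq0 addrC addKr.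
by rewrite h b0.
Qed.

Lemma to_complex_inj : injective (@to_complex R k).
Proof. exact: fmorph_inj. Qed.

Lemma to_complex_ratio (n N : nat) :
  to_complex k (n%:R / N%:R : K) = (n%:R / N%:R : R)%:C%C.
Proof. by rewrite fmorph_div !rmorph_nat rmorphM fmorphV !rmorph_nat. Qed.

Lemma modulus_ratio (n N : nat) : modulus (n%:R / N%:R : K) = n%:R / N%:R.
Proof.
by rewrite /modulus to_complex_ratio /= expr0n/= addr0 sqrtr_sqr ger0_norm.
Qed.

Lemma sum_Re (I : finType) (t : I -> K) n : \sum_i t i = n%:R ->
  \sum_i complex.Re (to_complex k (t i)) = n%:R.
Proof.
move=> tn; have := congr1 (fun z => complex.Re (to_complex k z)) tn.
rewrite /= rmorph_sum rmorph_nat /=.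
rewrite (big_morph _ ReD (erefl (complex.Re 0))) => ->.
by rewrite -(rmorph_nat (real_complex R)).
Qed.

End Modulus.

(** * The optimal error *)

Section OptimalError.
Variables (R : realType) (k : scalar_kind).
Local Notation K := (scalars R k).
Variables (H : vectType K) (dot : {dot H for scalar_conj k}) (N : nat) (p : R).
Hypothesis p1 : 1 < p.
Implicit Types (F G : 'I_N -> H).
Local Notation n := (\dim {:H}).
Hypothesis nN : (n <= N)%N.

Let ratio_ge0 : 0 <= n%:R / N%:R :> R.
Proof. by rewrite divr_ge0. Qed.

(* For [N = 0] the quotient is 0, and so is [n]. *)
Let ratioN : (n%:R / N%:R) *+ N = n%:R :> R.
Proof.
have [N0|N0] := posnP N; last by rewrite -mulr_natr mulfVK// pnatr_eq0 -lt0n.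
by have := nN; rewrite {1}N0 leqn0 => /eqP ->; rewrite mul0r mul0rn.
Qed.

Lemma sum_modulus_ge F G : dual_pair dot F G ->
  (n%:R / N%:R) *+ N <= \sum_i modulus (dot (G i) (F i)).
Proof.
move=> [_ _ /sum_dot_dual/sum_Re]; rewrite ratioN => <-.
by apply: ler_sum => i _; apply: Re_le_modulus.
Qed.

Lemma erasure_error_ge F G : dual_pair dot F G ->
  n%:R / N%:R <= erasure_error dot p F G.
Proof.
move=> FG; rewrite erasure_errorE; have [N0|N0] := posnP N.
  by rewrite [in leLHS]N0 invr0 mulr0 powR_ge0.
apply: power_mean_ge => //; last exact: sum_modulus_ge.
by move=> i; apply: modulus_ge0.
Qed.

Lemma erasure_error_eq F G : dual_pair dot F G ->
  erasure_error dot p F G = n%:R / N%:R <->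
  forall i, dot (G i) (F i) = n%:R / N%:R.
Proof.
move=> FG; rewrite erasure_errorE; split => [E i|t]; last first.
  have [N0|N0] := posnP N.
    rewrite big1; last first.
      by move=> i; have := ltn_ord i; rewrite [X in (_ < X)%N]N0.
    rewrite N0 invr0 !mulr0 powR0//.
    by rewrite invr_eq0 gt_eqF// (lt_trans _ p1).
  by apply: power_mean_const => // i; rewrite t modulus_ratio.
have am : forall i, modulus (dot (G i) (F i)) = n%:R / N%:R.
  apply: (power_mean_eq p1) => //; last exact: sum_modulus_ge.
  by move=> j; apply: modulus_ge0.
apply: (@to_complex_inj R k); rewrite to_complex_ratio -(am i).
apply: modulus_eq_Re.
have [_ _ /sum_dot_dual/sum_Re sRe] := FG.
(* The moduli and the real parts have the same sum, and the former dominate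
   the latter. *)
have /eqP : \sum_i (modulus (dot (G i) (F i)) -
                    complex.Re (to_complex k (dot (G i) (F i)))) = 0.
  rewrite sumrB sRe; under eq_bigr do rewrite am.
  by rewrite sumr_const card_ord ratioN subrr.
rewrite psumr_eq0 => [/allP/(_ i)|j _]; last by rewrite subr_ge0 Re_le_modulus.
by rewrite mem_index_enum subr_eq0 => /(_ isT)/eqP.
Qed.

(** By the trace identity the only possible constant is [n / N]. *)
Lemma one_uniformP F G : dual_pair dot F G ->
  one_uniform dot F G <-> forall i, dot (G i) (F i) = n%:R / N%:R.
Proof.
move=> FG; split=> [[_ [c cE]] i|t].
  have [_ _ /sum_dot_dual <-] := FG.
  under eq_bigr do rewrite dotC cE.
  rewrite dotC cE sumr_const card_ord.
  rewrite -[scalar_conj _ _ *+ _]mulr_natr mulfK// pnatr_eq0 -lt0n.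
  exact: leq_ltn_trans (ltn_ord i).
by split=> //; exists (n%:R / N%:R) => i; rewrite dotC t fmorph_div !rmorph_nat.
Qed.

Lemma optimal_errorE : optimal_error dot N p = n%:R / N%:R.
Proof.
have [F [G [FG /(erasure_error_eq FG) E]]] := exists_uniform_dual_pair dot nN.
rewrite /optimal_error; set A := (X in inf X).
have lbA : lbound A (n%:R / N%:R).
  by move=> _ [F' [G' [FG' ->]]]; apply: erasure_error_ge.
have Am : A (n%:R / N%:R) by exists F, G.
apply/le_anti/andP; split; first by apply: ge_inf => //; exists (n%:R / N%:R).
by apply: lb_le_inf => //; exists (n%:R / N%:R).
Qed.

End OptimalError.

Theorem proposition3p1 (R : realType) (k : scalar_kind) (n N : nat)
    (H : vectType (scalars R k)) (dot : {dot H for scalar_conj k}) (p : R)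
    (dimH : \dim {:H} = n) (le_nN : (n <= N)%N) (p_gt1 : 1 < p) :
  optimal_error dot N p = n%:R / N%:R /\
  forall F G : 'I_N -> H, dual_pair dot F G ->
    (spectrally_optimal dot p F G <-> one_uniform dot F G).
Proof.
subst n; have optE := optimal_errorE dot p_gt1 le_nN.
split=> // F G FG; rewrite /spectrally_optimal optE one_uniformP//.
by rewrite -(erasure_error_eq p_gt1 le_nN FG); split=> [[]|].
Qed.
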